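(* Consider the Wasserstein distributionally robust problem described in the context, with Euclidean ground metric and loss $\ell(\boldsymbol x,\boldsymbol\xi)=L(\boldsymbol\xi^\top\boldsymbol x)$, where $L:\mathbb R\to\mathbb R_+$ is convex and Lipschitz with constant $\mathrm{Lip}(L)$. Suppose that $\mathrm{diam}(\Xi)=\sup\{\|\boldsymbol\xi-\boldsymbol\xi'\|_2:\boldsymbol\xi,\boldsymbol\xi'\in\Xi\}<\infty$. Then, for every $\rho\in[0,+\infty)$, the additive suboptimality $\hat f_\rho-f^\star_\rho$ of the shrinkage path heuristic satisfies $$\hat f_\rho-f^\star_\rho\;\le\;\rho\left[1-\frac{\rho}{\mathrm{diam}(\Xi)}\right]_+\mathrm{Lip}(L)\,\|\boldsymbol x(0)\|_2 ,$$ where the right-hand side, as a function of $\rho\ge 0$, is maximized at $\rho=\mathrm{diam}(\Xi)/2$. Moreover, the bound is pointwise tight: for every $\rho\in[0,\infty)$ there exists a problem instance (satisfying all the assumptions above) for which the inequality holds with equality at this $\rho$.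
   Context: Setting. $n\in\mathbb N$; the decision $\boldsymbol x$ and the uncertain vector $\boldsymbol\xi$ both have dimension $n$ (so $k=n$). $\mathcal X\subseteq\mathbb R^n$ is closed and convex; $\Xi\subseteq\mathbb R^n$ is non-empty, closed and convex; $g_1,\dots,g_M$ are constraint functions with $g_m(\cdot,\boldsymbol\xi)$ closed convex for each $\boldsymbol\xi$, and $\gamma_1,\dots,\gamma_M\in\mathbb R$. The feasible set (for every radius) is $\mathcal X(\Xi)=\{\boldsymbol x\in\mathcal X: g_m(\boldsymbol x,\boldsymbol\xi)\le\gamma_m\ \forall\boldsymbol\xi\in\Xi,\ \forall m\in[M]\}$, assumed non-empty. The empirical distribution is $\hat{\mathbb P}=\frac1N\sum_{i=1}^N\delta_{\hat{\boldsymbol\xi}_i}$ with samples $\hat{\boldsymbol\xi}_i\in\Xi$. The type-1 Wasserstein distance is $W(\mathbb Q,\hat{\mathbb P})=\inf_{\pi\in\Pi(\mathbb Q,\hat{\mathbb P})}\int\|\boldsymbol\xi-\boldsymbol\xi'\|_2\,\pi(\mathrm d\boldsymbol\xi,\mathrm d\boldsymbol\xi')$ ($\Pi$ = set of couplings), and $\mathbb B_\rho(\hat{\mathbb P})=\{\mathbb Q\in\mathcal P(\Xi):W(\mathbb Q,\hat{\mathbb P})\le\rho\}$, where $\mathcal P(\Xi)$ is the set of probability measures on $\Xi$. Values. $f_\rho(\boldsymbol x)=\sup_{\mathbb Q\in\mathbb B_\rho(\hat{\mathbb P})}\mathbb E_{\mathbb Q}[\ell(\boldsymbol x,\tilde{\boldsymbol\xi})]$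 and $f^\star_\rho$ is the optimal value of minimizing $f_\rho$ over $\mathcal X(\Xi)$. $\boldsymbol x(0)$ is a fixed optimal solution of the sample average approximation problem $\min_{\boldsymbol x\in\mathcal X(\Xi)}\mathbb E_{\hat{\mathbb P}}[\ell(\boldsymbol x,\tilde{\boldsymbol\xi})]$, and $\boldsymbol x(\infty)$ is a fixed optimal solution of the robust problem $\min_{\boldsymbol x\in\mathcal X(\Xi)}\sup_{\boldsymbol\xi\in\Xi}\ell(\boldsymbol x,\boldsymbol\xi)$; both problems are assumed to attain finite optimal values. The shrinkage path is the segment $\{(1-\lambda)\boldsymbol x(0)+\lambda\boldsymbol x(\infty):\lambda\in[0,1]\}$, and the value of the shrinkage path heuristic is $\hat f_\rho=\min_{\lambda\in[0,1]}f_\rho((1-\lambda)\boldsymbol x(0)+\lambda\boldsymbol x(\infty))$. $[\cdot]_+=\max\{\cdot,0\}$; $\mathrm{Lip}(L)$ is the (least) Lipschitz constant of $L$. If $\mathrm{diam}(\Xi)=0$, the bound is read as $0$. *)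

(* Defs.v *)
From HB Require Import structures.
From mathcomp Require Import all_boot all_order all_algebra.
From mathcomp Require Import all_classical all_reals all_analysis.

Set Implicit Arguments.
Unset Strict Implicit.
Unset Printing Implicit Defensive.

Import Order.TTheory GRing.Theory Num.Theory.
Import numFieldNormedType.Exports.

Local Open Scope classical_set_scope.
Local Open Scope ring_scope.
Local Open Scope ereal_scope.

(* The canonical norm of 'rV[R]_n is the sup norm, so the Euclidean structure
   is introduced separately; both norms induce the same topology. *)
Definition dot (R : realType) (n : nat) (x y : 'rV[R]_n) : R :=
  (\sum_(i < n) x 0 i * y 0 i)%R.

Definition norm2 (R : realType) (n : nat) (x : 'rV[R]_n) : R :=
  Num.sqrt (dot x x).

Definition diam (R : realType) (n : nat) (A : set 'rV[R]_n) : \bar R :=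
  ereal_sup [set (norm2 (p.1 - p.2))%:E | p in A `*` A].

(* R^n equipped with its Borel sigma-algebra. *)
Definition borel (R : realType) (n : nat) : measurableType _ :=
  g_sigma_algebraType (@open 'rV[R]_n).

(* For extended-real valued functions: the epigraph is closed and convex. *)
Definition closed_convex_fun (R : realType) (n : nat) (f : 'rV[R]_n -> \bar R) :=
  let epi := [set p : 'rV[R]_n * R^o | f p.1 <= (p.2)%:E] in
  closed epi /\ convex_set epi.

(* The least Lipschitz constant. On the real line, a k satisfying
   k.-lipschitz L is automatically nonnegative. *)
Definition Lip (R : realType) (L : R -> R) : R :=
  inf [set k | k.-lipschitz (L : R^o -> R^o)].

Definition optimal (R : realType) (T : Type) (A : set T) (F : T -> \bar R)
    (x : T) :=
  A x /\ forall y, A y -> F x <= F y.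

Definition empirical (R : realType) (n N : nat) (s : N.-tuple 'rV[R]_n) :
    {measure set (borel R n) -> \bar R} :=
  mscale ((N%:R^-1)%:nng)%R (msum (fun i => dirac (nth 0%R s i : borel R n)) N).

Definition couplings (R : realType) (n : nat)
    (Q P : {measure set (borel R n) -> \bar R}) :
    set (probability (borel R n * borel R n)%type R) :=
  [set pi : probability (borel R n * borel R n)%type R |
    (forall A, measurable A -> pi (A `*` setT) = Q A) /\
    (forall A, measurable A -> pi (setT `*` A) = P A)].

Definition wasserstein (R : realType) (n : nat)
    (Q P : {measure set (borel R n) -> \bar R}) : \bar R :=
  ereal_inf [set \int[pi]_p (norm2 ((p.1 : 'rV[R]_n) - p.2))%:E
            | pi in couplings Q P].

(* Distributions on Xi are represented as Borel probability measures Q on R^n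
   with Q Xi = 1. *)
Definition ball_W (R : realType) (n : nat) (Xi : set 'rV[R]_n)
    (P : {measure set (borel R n) -> \bar R}) (rho : R) :
    set (probability (borel R n) R) :=
  [set Q : probability (borel R n) R | Q Xi = 1 /\ wasserstein Q P <= rho%:E].

Record problem (R : realType) (n : nat) := Problem {
  decisions : set 'rV[R]_n ;
  uncertainty : set 'rV[R]_n ;
  nb_constraints : nat ;
  constraint : 'I_nb_constraints -> 'rV[R]_n -> 'rV[R]_n -> \bar R ;
  rhs : 'I_nb_constraints -> R ;
  nb_samples : nat ;
  samples : nb_samples.-tuple 'rV[R]_n ;
  scalar_loss : R -> R }.

Section problem_values.
Variables (R : realType) (n : nat) (p : problem R n).

Definition feasible : set 'rV[R]_n :=
  [set x | decisions p x /\
           forall xi, uncertainty p xi ->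
           forall m, constraint m x xi <= (@rhs _ _ p m)%:E].

Definition loss (x xi : 'rV[R]_n) : R := scalar_loss p (dot xi x).

Definition saa_value (x : 'rV[R]_n) : \bar R :=
  \int[empirical (samples p)]_xi (loss x xi)%:E.

Definition robust_value (x : 'rV[R]_n) : \bar R :=
  ereal_sup [set (loss x xi)%:E | xi in uncertainty p].

Definition dro_value (rho : R) (x : 'rV[R]_n) : \bar R :=
  ereal_sup [set \int[Q]_xi (loss x xi)%:E
            | Q in ball_W (uncertainty p) (empirical (samples p)) rho].

Definition dro_opt (rho : R) : \bar R :=
  ereal_inf [set dro_value rho x | x in feasible].

Definition standing_assumptions :=
  (closed (decisions p) /\ convex_set (decisions p)) /\
  (uncertainty p !=set0 /\ closed (uncertainty p) /\
     convex_set (uncertainty p)) /\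
  (forall m xi, uncertainty p xi ->
     closed_convex_fun (fun x => @constraint _ _ p m x xi)) /\
  feasible !=set0 /\
  (0 < nb_samples p)%N /\
  (forall i, uncertainty p (tnth (samples p) i)) /\
  (forall t, 0 <= scalar_loss p t)%R /\
  convex_function setT (scalar_loss p : R^o -> R^o) /\
  (exists k, k.-lipschitz (scalar_loss p : R^o -> R^o)) /\
  diam (uncertainty p) < +oo.

Definition saa_solution (x : 'rV[R]_n) :=
  optimal feasible saa_value x /\ saa_value x \is a fin_num.

Definition robust_solution (x : 'rV[R]_n) :=
  optimal feasible robust_value x /\ robust_value x \is a fin_num.

Definition shrinkage_path (x0 xoo : 'rV[R]_n) : set 'rV[R]_n :=
  [set ((1 - t) *: x0 + t *: xoo)%R | t in `[0%R, 1%R]].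

Definition path_value (x0 xoo : 'rV[R]_n) (rho : R) : \bar R :=
  ereal_inf [set dro_value rho x | x in shrinkage_path x0 xoo].

(* The case distinction is needed because division by 0 yields 0. *)
Definition gap_bound (x0 : 'rV[R]_n) (rho : R) : R :=
  let D := fine (diam (uncertainty p)) in
  (if D == 0 then 0
   else rho * Num.max (1 - rho / D) 0 * Lip (scalar_loss p) * norm2 x0)%R.

End problem_values.

(* Main.v *)
(* With D the diameter of Xi and w = min (rho / D) 1, moving the mass fraction w
   of the empirical distribution P to one xi in Xi costs at most w D <= rho, so
   f_rho(x) >= (1 - w) E_P[l(x, .)] + w sup_xi l(x, xi); hence the optimal value
   is at least (1 - w) E_P[l(x(0), .)] + w sup_xi l(x(oo), xi).  Conversely f_rho
   is convex and bounded both by E_P[l(x, .)] + rho Lip(L) |x| (integrate the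
   Lipschitz estimate against a coupling) and by sup_xi l(x, xi); using the first
   bound at x(0) and the second at x(oo), the point of the path with parameter w
   has value at most the lower bound plus (1 - w) rho Lip(L) |x(0)|.

   For tightness, f_rho has to be constant on the path while some feasible x*
   off the path is both SAA-optimal and robust-optimal: take xi = (z, 1) with
   0 <= z <= D, the single sample (0, 1), L = |.|, and decisions x >= 0 with
   D x_1 + x_2 >= rho.  Then x(0) = (1, 0), x(oo) = (0, rho) and
   x* = (rho / D, 0). *)
Require Import Defs.
From HB Require Import structures.
From mathcomp Require Import all_boot all_order all_algebra.
From mathcomp Require Import all_classical all_reals all_analysis.
From mathcomp Require Import measurable_realfun ring lra.

Set Implicit Arguments.
Unset Strict Implicit.
Unset Printing Implicit Defensive.

Import Order.TTheory GRing.Theory Num.Theory.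
Import numFieldNormedType.Exports.

Local Open Scope classical_set_scope.
Local Open Scope ring_scope.

(** * Averages of two-atom probability measures *)

Section two_atom_mixture.
Context {d} {T : measurableType d} {R : realType}.
Variables (N : nat) (u v : {nonneg R}) (a b : nat -> T).

Let mix : measure T R := mscale (N%:R^-1)%:nng
  (msum (fun i => measure_add (mscale u \d_(a i)) (mscale v \d_(b i))) N).

Let mixE (A : set T) : mix A =
  (N%:R^-1 * \sum_(i < N) (u%:num * \1_A (a i) + v%:num * \1_A (b i)))%:E.
Proof.
rewrite /mix /= {1}/mscale EFinM -sumEFin; congr (_ * _)%E.
apply: eq_bigr => i _.
transitivity (mscale u \d_(a i) A + mscale v \d_(b i) A)%E.
  exact: measure_addE.
rewrite /mscale /= !diracE.
by rewrite !indicE EFinD !EFinM.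
Qed.

(** Generic in [T] because it is applied twice: on R^n to build a perturbed distribution, and on the
    product space to build the coupling that bounds its transport cost. *)
Lemma two_atom_mixture_ex : (0 < N)%N -> u%:num + v%:num = 1 ->
  exists P : probability T R,
    (forall A, P A =
      (N%:R^-1 * \sum_(i < N) (u%:num * \1_A (a i) + v%:num * \1_A (b i)))%:E) /\
    (forall f : T -> R, (forall x, 0 <= f x) -> measurable_fun setT f ->
      (\int[P]_x (f x)%:E =
       (N%:R^-1 * \sum_(i < N) (u%:num * f (a i) + v%:num * f (b i)))%:E)%E).
Proof.
move=> N0 uv1.
have mixT : mix setT = 1%E.
  rewrite mixE; under eq_bigr do rewrite !indicT !mulr1 uv1.
  rewrite sumr_const card_ord mulVf //.
  by rewrite pnatr_eq0 -lt0n.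
(* [mix] already has mass 1, so [mnormalize] leaves it unchanged and only supplies the probability
   structure; the Dirac mass is the default for a degenerate total mass. *)
have PE A : mnormalize mix \d_(a 0%N) A = mix A.
  by rewrite /mnormalize mixT onee_eq0 /= invr1 mule1.
exists (mnormalize mix \d_(a 0%N)); split=> [A|f f0 mf].
  by rewrite [LHS]PE mixE.
have f0' x : [set: T] x -> (0 <= (f x)%:E)%E by rewrite lee_fin.
have mf' : measurable_fun setT (EFin \o f) by exact/measurable_EFinP.
rewrite (@eq_measure_integral _ _ _ setT mix) => [|A _ _]; last exact: PE.
rewrite ge0_integral_mscale //= EFinM; congr (_ * _)%E.
rewrite ge0_integral_measure_sum // -sumEFin; apply: eq_bigr => i _.
rewrite ge0_integral_measure_add // !ge0_integral_mscale // !integral_dirac //.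
by rewrite !diracT !mul1e EFinD !EFinM.
Qed.

End two_atom_mixture.

(** * Euclidean inner product and the Cauchy-Schwarz inequality *)

Section euclidean.
Context {R : realType} {n : nat}.
Implicit Types x y z : 'rV[R]_n.

Lemma dotC x y : dot x y = dot y x.
Proof. by rewrite /dot; apply: eq_bigr => i _; rewrite mulrC. Qed.

Lemma dotDr x y z : dot x (y + z) = dot x y + dot x z.
Proof.
by rewrite /dot -big_split; apply: eq_bigr => i _; rewrite mxE mulrDr.
Qed.

Lemma dotZr (k : R) x y : dot x (k *: y) = k * dot x y.
Proof.
by rewrite /dot mulr_sumr; apply: eq_bigr => i _; rewrite mxE mulrCA.
Qed.

Lemma dotBl x y z : dot (x - y) z = dot x z - dot y z.
Proof. by rewrite -scaleN1r dotC dotDr dotZr mulN1r !(dotC z). Qed.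

Lemma dot_ge0 x : 0 <= dot x x.
Proof. by apply: sumr_ge0 => i _; rewrite -expr2 sqr_ge0. Qed.

Lemma dot_eq0 x : dot x x = 0 -> x = 0.
Proof.
move=> /eqP; rewrite /dot psumr_eq0 => [/allP h|i _]; last first.
  by rewrite -expr2 sqr_ge0.
apply/rowP => i; rewrite mxE; apply/eqP.
by have := h i (mem_index_enum _); rewrite mulf_eq0 orbb.
Qed.

Lemma norm2_ge0 x : 0 <= norm2 x.
Proof. exact: sqrtr_ge0. Qed.

Lemma sqr_norm2 x : norm2 x ^+ 2 = dot x x.
Proof. by rewrite sqr_sqrtr ?dot_ge0. Qed.

Lemma norm2_0 : norm2 (0 : 'rV[R]_n) = 0.
Proof. by rewrite /norm2 /dot big1 ?sqrtr0 // => i _; rewrite mxE mul0r. Qed.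

Lemma dot_le_norm2 x y : `|dot x y| <= norm2 x * norm2 y.
Proof.
rewrite -(@ler_pXn2r _ 2) ?nnegrE ?mulr_ge0 ?norm2_ge0 //.
rewrite exprMn !sqr_norm2 real_normK ?num_real //.
have [/dot_eq0 ->|y0] := eqVneq (dot y y) 0.
  by rewrite -(scale0r y) !dotZr !mul0r mulr0 expr0n.
have {}y0 : 0 < dot y y by rewrite lt_neqAle eq_sym y0 dot_ge0.
(* The square of this vector expands to [dot y y] times the difference of the two sides of the
   squared inequality. *)
have := dot_ge0 (dot y y *: x + (- dot x y) *: y).
rewrite dotDr !dotZr !(dotC (_ + _)) !dotDr !dotZr (dotC y x) => h.
rewrite -subr_ge0 -(pmulr_rge0 _ y0); apply: le_trans h _.
by rewrite le_eqVlt; apply/orP; left; apply/eqP; ring.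
Qed.

End euclidean.

(** * Borel measurability on R^n and on pairs *)

Section borel_measurability.
Context {R : realType} {n : nat}.

Lemma measurable_coord (i : 'I_n) :
  measurable_fun setT (fun x : borel R n => (x : 'rV[R]_n) 0 i).
Proof.
apply: (measurability _ (RGenOpens.measurableE R)) => _ [_ [a [b ->]] <-].
rewrite setTI; apply: sub_sigma_algebra.
by apply: open_comp => [x _|]; [exact: coord_continuous | exact: interval_open].
Qed.

Lemma measurable_closed (A : set 'rV[R]_n) :
  closed A -> measurable (A : set (borel R n)).
Proof.
move=> cA; rewrite -(setCK A); apply: measurableC; apply: sub_sigma_algebra.
exact: closed_openC.
Qed.

Lemma measurable_dot (x : 'rV[R]_n) :
  measurable_fun setT (fun xi : borel R n => dot xi x).
Proof.
apply: measurable_sum => i; apply: measurable_funM => //.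
exact: measurable_coord.
Qed.

(** The pair space carries the product sigma-algebra, so measurability is assembled from the
    coordinates rather than read off from continuity of the distance. *)
Lemma measurable_dist2 : measurable_fun setT
  (fun p : borel R n * borel R n => norm2 ((p.1 : 'rV[R]_n) - p.2)).
Proof.
apply: measurableT_comp; first exact: continuous_measurable_fun (@sqrt_continuous R).
apply: measurable_sum => i.
have h : measurable_fun setT (fun p : borel R n * borel R n =>
    ((p.1 : 'rV[R]_n) - p.2) 0 i).
  rewrite (_ : (fun _ => _) = (fun p : borel R n * borel R n =>
    (p.1 : 'rV[R]_n) 0 i - (p.2 : 'rV[R]_n) 0 i)); last first.
    by apply/funext => p; rewrite !mxE.
  apply: measurable_funB.
    exact: (measurableT_comp (measurable_coord i) measurable_fst).
  exact: (measurableT_comp (measurable_coord i) measurable_snd).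
exact: measurable_funM.
Qed.

End borel_measurability.

(** * Lipschitz and convex functions on the line *)

Section lipschitz_functions.
Context {R : realType}.
Implicit Types f L : R -> R.

Lemma lipschitz_bound_continuous f (K : R) :
  (forall s t, `|f s - f t| <= K * `|s - t|) -> continuous f.
Proof.
move=> fK x; apply/cvgrPdist_lt => e e0; near=> y.
apply: (le_lt_trans (fK x y)).
(* [K] carries no sign here, hence the denominator |K| + 1, positive in every case. *)
have K0 : 0 < `|K| + 1 by rewrite ltr_wpDl.
have : `|x - y| < e / (`|K| + 1).
  by near: y; apply: cvgr_dist_lt; rewrite ?divr_gt0.
rewrite ltr_pdivlMr // => /(le_lt_trans _); apply.
rewrite mulrC ler_wpM2l //; apply: le_trans (ler_norm _) _.
by rewrite lerDl.
Unshelve. all: by end_near. Qed.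

Lemma klipschitzE L (k : R) : k.-lipschitz (L : R^o -> R^o) <->
  forall s t, `|L s - L t| <= k * `|s - t|.
Proof.
split=> [h s t|h [s t] _]; last exact: h.
by have := h (s, t); apply.
Qed.

Lemma klipschitz_ge0 L (k : R) : k.-lipschitz (L : R^o -> R^o) -> 0 <= k.
Proof.
move=> /klipschitzE /(_ 1 0); rewrite subr0 normr1 mulr1.
by apply: le_trans.
Qed.

Section least_constant.
Variable L : R -> R.
Hypothesis lipL : exists k, k.-lipschitz (L : R^o -> R^o).

Lemma Lip_ge0 : 0 <= Lip L.
Proof.
by apply: lb_le_inf => [|k /klipschitz_ge0 //]; case: lipL => k; exists k.
Qed.

(** The infimum defining [Lip] is itself a Lipschitz constant: for distinct points, the difference
    quotient is a lower bound of all admissible constants. *)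
Lemma LipP s t : `|L s - L t| <= Lip L * `|s - t|.
Proof.
have [->|st] := eqVneq s t; first by rewrite !subrr normr0 mulr0.
have {}st : 0 < `|s - t| by rewrite normr_gt0 subr_eq0.
rewrite -ler_pdivrMr //; apply: lb_le_inf => [|k /klipschitzE kL].
  by case: lipL => k; exists k.
by rewrite ler_pdivrMr.
Qed.

End least_constant.

Lemma convex_functionR L (t a b : R) : convex_function setT (L : R^o -> R^o) ->
  0 <= t -> t <= 1 -> L ((1 - t) * a + t * b) <= (1 - t) * L a + t * L b.
Proof.
move=> cL t0 t1; rewrite addrC [leRHS]addrC.
exact: (cL (Itv01 t0 t1) b a (mem_set I) (mem_set I)).
Qed.

End lipschitz_functions.

(** * Finite diameters *)

Section diameter.
Context {R : realType} {n : nat}.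
Variable A : set 'rV[R]_n.

Lemma diam_fin : A !=set0 -> (diam A < +oo)%E -> diam A \is a fin_num.
Proof.
move=> [x Ax] Dfin; rewrite ge0_fin_numE //; apply: ereal_sup_ubound.
by exists (x, x) => //=; rewrite subrr norm2_0.
Qed.

Lemma dist_le_diam x y : (diam A < +oo)%E -> A x -> A y ->
  norm2 (x - y) <= fine (diam A).
Proof.
move=> Dfin Ax Ay; rewrite -lee_fin fineK; last by apply: diam_fin; [exists x|].
by apply: ereal_sup_ubound; exists (x, y).
Qed.

End diameter.

(** * Couplings and the transport estimate *)

Section transport.
Context {R : realType} {n : nat}.
Implicit Types (f : 'rV[R]_n -> R) (Q P : {measure set (borel R n) -> \bar R}).

(** A marginal is the pushforward of [pi] by a projection, so this is a change of variables. *)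
Lemma integral_couplingl Q P pi f : couplings Q P pi -> (forall x, 0 <= f x) ->
  measurable_fun setT (f : borel R n -> R) ->
  (\int[Q]_x (f x)%:E = \int[pi]_q (f q.1)%:E)%E.
Proof.
move=> [piQ _] f0 mf.
rewrite (@eq_measure_integral _ _ _ setT (pushforward pi fst)); last first.
  by move=> B mB _; rewrite -piQ // setXT.
rewrite ge0_integral_pushforward ?preimage_setT //.
  exact/measurable_EFinP.
by move=> y _; rewrite lee_fin.
Qed.

Lemma integral_couplingr Q P pi f : couplings Q P pi -> (forall x, 0 <= f x) ->
  measurable_fun setT (f : borel R n -> R) ->
  (\int[P]_x (f x)%:E = \int[pi]_q (f q.2)%:E)%E.
Proof.
move=> [_ piP] f0 mf.
rewrite (@eq_measure_integral _ _ _ setT (pushforward pi snd)); last first.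
  by move=> B mB _; rewrite -piP // setTX.
rewrite ge0_integral_pushforward ?preimage_setT //.
  exact/measurable_EFinP.
by move=> y _; rewrite lee_fin.
Qed.

(** The easy direction of Kantorovich-Rubinstein duality: integrate the pointwise estimate against a
    nearly optimal coupling, then let its excess cost vanish. *)
Lemma integral_le_wasserstein Q P f (K rho : R) : 0 <= K ->
  (wasserstein Q P <= rho%:E)%E -> (forall x, 0 <= f x) ->
  measurable_fun setT (f : borel R n -> R) ->
  (forall x y, f x <= f y + K * norm2 (x - y)) ->
  (\int[Q]_x (f x)%:E <= \int[P]_x (f x)%:E + (K * rho)%:E)%E.
Proof.
move=> K0 Wrho f0 mf fK; apply/lee_addgt0Pr => e e0.
(* A slack of [e / (K + 1)] in the coupling cost keeps the final excess K e / (K + 1) below e, also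
   when K = 0. *)
have K1 : 0 < K + 1 by rewrite ltr_wpDl.
have : (wasserstein Q P < (rho + e / (K + 1))%:E)%E.
  by apply: le_lt_trans Wrho _; rewrite lte_fin ltrDl divr_gt0.
move=> /ereal_inf_lt[_ [pi pic <-]] pie.
have mf1 : measurable_fun setT (fun q : borel R n * borel R n => f q.1).
  exact: (measurableT_comp mf measurable_fst).
have mf2 : measurable_fun setT (fun q : borel R n * borel R n => f q.2).
  exact: (measurableT_comp mf measurable_snd).
have md := @measurable_dist2 R n.
have d0 (q : borel R n * borel R n) :
  (0 <= (norm2 ((q.1 : 'rV[R]_n) - q.2))%:E)%E by rewrite lee_fin norm2_ge0.
rewrite (integral_couplingl pic f0 mf) (integral_couplingr pic f0 mf).
apply: (@le_trans _ _ (\int[pi]_q ((f q.2)%:E +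
    K%:E * (norm2 ((q.1 : 'rV[R]_n) - q.2))%:E))%E).
  apply: ge0_le_integral => //=.
  - by move=> q _; rewrite lee_fin.
  - exact/measurable_EFinP.
  - by apply: emeasurable_funD; [|apply: measurable_funeM]; exact/measurable_EFinP.
  - by move=> q _; rewrite lee_fin.
rewrite ge0_integralD //=; last 4 first.
- by move=> q _; rewrite lee_fin.
- exact/measurable_EFinP.
- by move=> q _; rewrite -EFinM lee_fin mulr_ge0 ?norm2_ge0.
- by apply: measurable_funeM; exact/measurable_EFinP.
rewrite ge0_integralZl_EFin //; last exact/measurable_EFinP.
rewrite -[leRHS]addeA; apply: leeD2l; rewrite -[leRHS]/((K * rho + e)%:E).
apply: (@le_trans _ _ (K%:E * (rho + e / (K + 1))%:E)%E).
  by rewrite lee_wpmul2l ?lee_fin // ltW.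
rewrite -EFinM lee_fin mulrDr lerD2l mulrCA ger_pMr //.
by rewrite ler_pdivrMr // mul1r lerDl.
Qed.

End transport.

(** * The empirical distribution and its perturbations in the ball *)

Section empirical_distribution.
Context {R : realType} {n N : nat}.
Variable s : N.-tuple 'rV[R]_n.

Lemma integral_empirical (f : 'rV[R]_n -> R) : (forall x, 0 <= f x) ->
  measurable_fun setT (f : borel R n -> R) ->
  (\int[empirical s]_x (f x)%:E = (N%:R^-1 * \sum_(i < N) f (nth 0 s i))%:E)%E.
Proof.
move=> f0 mf; have mf' : measurable_fun setT (EFin \o f : borel R n -> _).
  exact/measurable_EFinP.
rewrite ge0_integral_mscale //=; last by move=> x _; rewrite lee_fin.
rewrite EFinM; congr (_ * _)%E.
rewrite ge0_integral_measure_sum //; last by move=> x _; rewrite lee_fin.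
rewrite -sumEFin; apply: eq_bigr => i _.
by rewrite integral_dirac // diracT mul1e.
Qed.

Lemma empiricalE (A : set (borel R n)) :
  empirical s A = (N%:R^-1 * \sum_(i < N) \1_A (nth 0 s i : borel R n))%:E.
Proof.
by rewrite /= {1}/mscale EFinM -sumEFin; congr (_ * _)%E.
Qed.

(* The coupling leaves the fraction 1 - w of each sample in place and pairs the
   rest with xi, at cost w * D. *)
Lemma ball_W_mixture (Xi : set 'rV[R]_n) (rho w D : R) (xi : 'rV[R]_n) :
  (0 < N)%N -> closed Xi -> (forall i, Xi (tnth s i)) -> Xi xi ->
  (forall x y, Xi x -> Xi y -> norm2 (x - y) <= D) ->
  0 <= w -> w <= 1 -> w * D <= rho ->
  exists2 Q : probability (borel R n) R, ball_W Xi (empirical s) rho Q &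
    forall f : 'rV[R]_n -> R, (forall x, 0 <= f x) ->
      measurable_fun setT (f : borel R n -> R) ->
      (\int[Q]_x (f x)%:E =
        ((1 - w) * (N%:R^-1 * \sum_(i < N) f (nth 0 s i)) + w * f xi)%:E)%E.
Proof.
move=> N0 cXi Xis Xixi XiD w0 w1 wD.
have N0' : N%:R != 0 :> R by rewrite pnatr_eq0 -lt0n.
have nthXi (i : 'I_N) : Xi (nth 0 s i) by rewrite -tnth_nth.
have w1' : 0 <= 1 - w by rewrite subr_ge0.
pose sn i : borel R n := nth 0 s i.
have uv1 : (NngNum w1')%:num + (NngNum w0)%:num = 1 :> R by rewrite /= subrK.
have [Q [QE Qint]] := two_atom_mixture_ex sn (fun _ => xi) N0 uv1.
have [pi [piE piint]] := two_atom_mixture_ex (fun i => (sn i, sn i))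
  (fun i => (xi : borel R n, sn i)) N0 uv1.
exists Q; last first.
  move=> f f0 mf; rewrite Qint //; congr EFin => /=.
  rewrite big_split /= sumr_const card_ord -mulr_sumr mulrDr mulrCA.
  by rewrite -(mulr_natl (w * f xi)) mulKf.
split.
  rewrite QE /= (eq_bigr (fun=> 1)).
    by rewrite sumr_const card_ord mulVf.
  by move=> i _; rewrite !indicE !mem_set // !mulr1 subrK.
rewrite /wasserstein.
apply: (@le_trans _ _ (\int[pi]_q (norm2 ((q.1 : 'rV[R]_n) - q.2))%:E)%E).
  apply: ereal_inf_lbound; exists pi => //; split=> A mA.
    rewrite piE [RHS]QE; congr (_ * _)%:E; apply: eq_bigr => i _.
    by rewrite !indicE !in_setX !in_setT !andbT.
  (* Both atoms of index i have the sample as second component, and their weights add up to 1. *)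
  rewrite piE empiricalE; congr (_ * _)%:E; apply: eq_bigr => i _.
  by rewrite !indicE !in_setX !in_setT /= -mulrDl subrK mul1r.
(* Diagonal atoms cost nothing and each atom (xi, s_i) contributes at most w D, hence so does the
   average. *)
rewrite piint; [|by move=> q; exact: norm2_ge0|exact: measurable_dist2].
rewrite lee_fin /= mulrC ler_pdivrMr ?ltr0n // mulr_natr.
rewrite -[in leRHS](card_ord N) -sumr_const; apply: ler_sum => i _.
rewrite subrr norm2_0 mulr0 add0r; apply: le_trans wD.
by rewrite ler_wpM2l // XiD // /sn.

Qed.
End empirical_distribution.

(** * Losses and values of a problem under the standing assumptions *)

Section problem_theory.
Context {R : realType} {n : nat}.
Variable p : problem R n.
Hypothesis hp : standing_assumptions p.

Let Xi := uncertainty p.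
Let L := scalar_loss p.
Let D := fine (diam Xi).
(** Real-valued form of [saa_value], open to ordered-field arithmetic; [saa_valueE] identifies the
    two. *)
Let saa (x : 'rV[R]_n) : R :=
  (nb_samples p)%:R^-1 * \sum_(i < nb_samples p) loss p x (nth 0 (samples p) i).

Let closed_Xi : closed Xi. Proof. by case: hp => _ [[_ []]]. Qed.

Let samples_gt0 : (0 < nb_samples p)%N.
Proof. by case: hp => _ [_ [_ [_ []]]]. Qed.

Let samples_Xi i : Xi (tnth (samples p) i).
Proof. by case: hp => _ [_ [_ [_ [_ [+ _]]]]]; apply. Qed.

Let L_ge0 t : 0 <= L t.
Proof. by case: hp => _ [_ [_ [_ [_ [_ [+ _]]]]]]; apply. Qed.

Let convex_L : convex_function setT (L : R^o -> R^o).
Proof. by case: hp => _ [_ [_ [_ [_ [_ [_ []]]]]]]. Qed.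

Let lip_L : exists k, k.-lipschitz (L : R^o -> R^o).
Proof. by case: hp => _ [_ [_ [_ [_ [_ [_ [_ []]]]]]]]. Qed.

Let diam_lty : (diam Xi < +oo)%E.
Proof. by case: hp => _ [_ [_ [_ [_ [_ [_ [_ []]]]]]]]. Qed.

Lemma uncertainty_dist_le a b : Xi a -> Xi b -> norm2 (a - b) <= D.
Proof. exact: dist_le_diam. Qed.

Lemma uncertainty_diam_ge0 : 0 <= D.
Proof.
apply: le_trans (uncertainty_dist_le (samples_Xi (Ordinal samples_gt0))
  (samples_Xi (Ordinal samples_gt0))).
exact: norm2_ge0.
Qed.

Lemma loss_ge0 x xi : 0 <= loss p x xi. Proof. exact: L_ge0. Qed.

Lemma measurable_loss x : measurable_fun setT (loss p x : borel R n -> R).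
Proof.
apply: measurableT_comp; last exact: measurable_dot.
apply: continuous_measurable_fun.
exact: lipschitz_bound_continuous (LipP lip_L).
Qed.

(** Cauchy-Schwarz turns the scalar Lipschitz estimate into one in the uncertain vector, which is
    where the factor [norm2 x] of the gap bound originates. *)
Lemma loss_lipschitz x a b :
  loss p x a <= loss p x b + Lip L * norm2 x * norm2 (a - b).
Proof.
rewrite -lerBlDl; apply: le_trans (ler_norm _) _.
apply: le_trans (LipP lip_L _ _) _; rewrite -mulrA ler_wpM2l ?Lip_ge0 //.
by rewrite -dotBl mulrC dot_le_norm2.
Qed.

Lemma saa_valueE x : saa_value p x = (saa x)%:E.
Proof. exact: integral_empirical (loss_ge0 x) (measurable_loss x). Qed.

(** * Bounds, convexity and continuity of f_rho *)

Section dro_value_bounds.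
Variable rho : R.
Implicit Types x y : 'rV[R]_n.

Lemma dro_value_le x (c : \bar R) :
  (forall Q, ball_W Xi (empirical (samples p)) rho Q ->
     (\int[Q]_xi (loss p x xi)%:E <= c)%E) ->
  (dro_value p rho x <= c)%E.
Proof. by move=> h; apply: ge_ereal_sup => _ [Q /h Qc <-]. Qed.

Lemma le_dro_value x Q : ball_W Xi (empirical (samples p)) rho Q ->
  (\int[Q]_xi (loss p x xi)%:E <= dro_value p rho x)%E.
Proof. by move=> hQ; apply: ereal_sup_ubound; exists Q. Qed.

Lemma dro_value_le_saa x :
  (dro_value p rho x <= (saa x + rho * Lip L * norm2 x)%:E)%E.
Proof.
apply: dro_value_le => Q [_ WQ].
rewrite EFinD -saa_valueE -mulrA mulrC.
apply: integral_le_wasserstein WQ (loss_ge0 x) (measurable_loss x) _.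
  by rewrite mulr_ge0 ?Lip_ge0 ?norm2_ge0.
exact: loss_lipschitz.
Qed.

(** Measures of the ball live on R^n, so a comparison on [Xi] holds only almost everywhere; the
    complement of [Xi] is measurable because [Xi] is closed, and null for [Q]. *)
Lemma le_integral_uncertainty (Q : probability (borel R n) R)
    (f g : 'rV[R]_n -> R) : Q Xi = 1%E ->
  (forall x, 0 <= f x) -> (forall x, 0 <= g x) ->
  measurable_fun setT (f : borel R n -> R) ->
  measurable_fun setT (g : borel R n -> R) ->
  (forall x, Xi x -> f x <= g x) ->
  (\int[Q]_x (f x)%:E <= \int[Q]_x (g x)%:E)%E.
Proof.
move=> QXi f0 g0 mf mg fg.
have mXi := measurable_closed closed_Xi.
apply: ae_ge0_le_integral => //.
- by move=> x _; rewrite lee_fin.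
- exact/measurable_EFinP.
- by move=> x _; rewrite lee_fin.
- exact/measurable_EFinP.
- exists (~` Xi); split; first exact: measurableC.
    by transitivity (1 - Q Xi)%E; [exact: probability_setC|rewrite QXi subee].
  by move=> x /= h Xix; apply: h => _; rewrite lee_fin fg.
Qed.

(** Transfers a loss estimate uniform over [Xi] to f_rho; this yields Lipschitz continuity along the
    path in [path_value_attained]. *)
Lemma dro_value_le_translate x y c : 0 <= c ->
  (forall xi, Xi xi -> loss p x xi <= loss p y xi + c) ->
  (dro_value p rho x <= dro_value p rho y + c%:E)%E.
Proof.
move=> c0 xyc; apply: dro_value_le => Q hQ.
apply: (@le_trans _ _ (\int[Q]_xi (loss p y xi + c)%:E)%E).
  apply: le_integral_uncertainty => //; first by case: hQ.
  - exact: loss_ge0.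
  - by move=> xi; rewrite addr_ge0 ?loss_ge0.
  - exact: measurable_loss.
  - by apply: measurable_funD => //; exact: measurable_loss.
under eq_integral do rewrite EFinD.
rewrite ge0_integralD //=; last 2 first.
- by move=> xi _; rewrite lee_fin loss_ge0.
- by apply/measurable_EFinP; exact: measurable_loss.
apply: leeD; first exact: le_dro_value.
by rewrite integral_cst // [X in (_ * X)%E]probability_setT mule1.
Qed.

Lemma dro_value_le_robust x c : (forall xi, Xi xi -> loss p x xi <= c) ->
  (dro_value p rho x <= c%:E)%E.
Proof.
move=> xc; apply: dro_value_le => Q hQ.
have c0 : 0 <= c.
  exact: le_trans (loss_ge0 x _) (xc _ (samples_Xi (Ordinal samples_gt0))).
apply: (@le_trans _ _ (\int[Q]_xi c%:E)%E); last first.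
  by rewrite integral_cst // [X in (_ * X)%E]probability_setT mule1.
apply: le_integral_uncertainty => //; first by case: hQ.
- exact: loss_ge0.
- exact: measurable_loss.
Qed.

(** Convexity holds for each [Q] separately and survives the supremum. Real bounds [a] and [b]
    replace the two values, so that a different kind of estimate can be plugged in at each
    endpoint. *)
Lemma dro_value_le_convex x y a b t : 0 <= t -> t <= 1 ->
  (dro_value p rho x <= a%:E)%E -> (dro_value p rho y <= b%:E)%E ->
  (dro_value p rho ((1 - t) *: x + t *: y) <= ((1 - t) * a + t * b)%:E)%E.
Proof.
move=> t0 t1 xa yb; apply: dro_value_le => Q hQ.
have t1' : 0 <= 1 - t by rewrite subr_ge0.
have mloss z := measurable_loss z.
have eloss z xi : [set: borel R n] xi -> (0 <= (loss p z xi)%:E)%E.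
  by rewrite lee_fin loss_ge0.
apply: (@le_trans _ _ (\int[Q]_xi ((1 - t)%:E * (loss p x xi)%:E +
    t%:E * (loss p y xi)%:E))%E).
  apply: ge0_le_integral => //=.
  - exact: eloss.
  - exact/measurable_EFinP.
  - apply: emeasurable_funD; apply: measurable_funeM; exact/measurable_EFinP.
  - move=> xi _; rewrite -!EFinM -EFinD lee_fin /loss dotDr !dotZr.
    exact: convex_functionR.
rewrite ge0_integralD //=; last 4 first.
- by move=> xi _; rewrite -EFinM lee_fin mulr_ge0 ?loss_ge0.
- by apply: measurable_funeM; exact/measurable_EFinP.
- by move=> xi _; rewrite -EFinM lee_fin mulr_ge0 ?loss_ge0.
- by apply: measurable_funeM; exact/measurable_EFinP.
rewrite !ge0_integralZl_EFin //; try exact: eloss; try exact/measurable_EFinP.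
rewrite [leRHS]EFinD !EFinM; apply: leeD; rewrite lee_wpmul2l ?lee_fin //.
  exact: le_trans (le_dro_value _ hQ) xa.
exact: le_trans (le_dro_value _ hQ) yb.
Qed.

Lemma dro_value_ge x w xi : 0 <= w -> w <= 1 -> w * D <= rho -> Xi xi ->
  (((1 - w) * saa x + w * loss p x xi)%:E <= dro_value p rho x)%E.
Proof.
move=> w0 w1 wD Xixi.
have [Q hQ Qint] := ball_W_mixture samples_gt0 closed_Xi samples_Xi Xixi
  uncertainty_dist_le w0 w1 wD.
rewrite -(Qint _ (loss_ge0 x) (measurable_loss x)).
exact: le_dro_value.
Qed.

Hypothesis rho0 : 0 <= rho.

(** This is the mixture of weight w = 0: the empirical distribution itself lies in every ball of
    nonnegative radius. *)
Lemma saa_le_dro_value x : ((saa x)%:E <= dro_value p rho x)%E.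
Proof.
have := dro_value_ge x (lexx 0) ler01 _ (samples_Xi (Ordinal samples_gt0)).
by rewrite subr0 mul1r !mul0r addr0; apply.
Qed.

Lemma dro_value_fin x : dro_value p rho x \is a fin_num.
Proof.
rewrite fin_numElt (lt_le_trans (ltNyr _) (saa_le_dro_value x)) /=.
exact: le_lt_trans (dro_value_le_saa x) (ltry _).
Qed.

(** Since [Xi] is bounded, f_rho is Lipschitz in the path parameter, and the extreme value theorem
    applies on [0, 1]. *)
Lemma path_value_attained x0 xoo : exists2 x, shrinkage_path x0 xoo x &
  dro_value p rho x = path_value p x0 xoo rho.
Proof.
pose path t := (1 - t) *: x0 + t *: xoo.
pose s0 := tnth (samples p) (Ordinal samples_gt0).
(* [C] bounds the inner products of [xoo - x0] with all of [Xi], by comparison with the fixed sample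
   [s0], at distance at most [D]. *)
pose C := `|dot s0 (xoo - x0)| + D * norm2 (xoo - x0).
have dot_le_C xi : Xi xi -> `|dot xi (xoo - x0)| <= C.
  move=> Xixi; rewrite -[dot xi _](subrKC (dot s0 (xoo - x0))) -dotBl.
  apply: le_trans (ler_normD _ _) _; rewrite lerD2l.
  apply: le_trans (dot_le_norm2 _ _) _; rewrite ler_wpM2r ?norm2_ge0 //.
  exact: uncertainty_dist_le Xixi (samples_Xi _).
have C0 : 0 <= C by rewrite addr_ge0 // mulr_ge0 ?uncertainty_diam_ge0 ?norm2_ge0.
have path_le s t :
    (dro_value p rho (path s) <=
     dro_value p rho (path t) + (Lip L * C * `|s - t|)%:E)%E.
  apply: dro_value_le_translate => [|xi Xixi].
    by rewrite !mulr_ge0 ?Lip_ge0.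
  rewrite -lerBlDl; apply: le_trans (ler_norm _) _.
  apply: le_trans (LipP lip_L _ _) _; rewrite -mulrA ler_wpM2l ?Lip_ge0 //.
  have -> : dot xi (path s) - dot xi (path t) = (s - t) * dot xi (xoo - x0).
    by rewrite /path -(scaleN1r x0) !dotDr !dotZr; ring.
  by rewrite normrM mulrC ler_wpM2r ?dot_le_C.
pose phi t := fine (dro_value p rho (path t)).
have phiE t : (phi t)%:E = dro_value p rho (path t) by rewrite fineK ?dro_value_fin.
have phi_le s t : phi s - phi t <= Lip L * C * `|s - t|.
  by rewrite lerBlDl -lee_fin EFinD !phiE.
have cphi : continuous phi.
  apply: (@lipschitz_bound_continuous _ _ (Lip L * C)) => s t.
  rewrite ler_norml phi_le andbT lerNl opprB distrC; exact: phi_le.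
have [c c01 phic] : exists2 c, c \in `[0, 1] &
    forall t, t \in `[0, 1] -> phi c <= phi t.
  by apply: EVT_min => //; exact: continuous_subspaceT.
exists (path c); first by exists c.
apply/eqP; rewrite eq_le; apply/andP; split.
  apply: le_ereal_inf_tmp => _ [_ [t t01 <-] <-].
  by rewrite -!phiE lee_fin phic.
by apply: ereal_inf_lbound; exists (path c) => //; exists c.
Qed.

End dro_value_bounds.

(** * The suboptimality bound *)

Section gap.
Variables (x0 xoo : 'rV[R]_n) (rho : R).
Hypotheses (hx0 : saa_solution p x0) (hxoo : robust_solution p xoo).
Hypothesis rho0 : 0 <= rho.

(* Dividing by D = 0 would give w = 0, whereas w = 1 is wanted there. *)
Let w := if D == 0 then 1 else Num.min (rho / D) 1.

Let w_ge0 : 0 <= w.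
Proof.
rewrite /w; case: ifPn => // _.
by rewrite le_min ler01 andbT divr_ge0 // uncertainty_diam_ge0.
Qed.

Let w_le1 : w <= 1.
Proof. by rewrite /w; case: ifPn => // _; rewrite ge_min lexx orbT. Qed.

Let wD : w * D <= rho.
Proof.
rewrite /w; case: ifPn => [/eqP ->|D0]; first by rewrite mulr0.
have {}D0 : 0 < D by rewrite lt_neqAle eq_sym D0 uncertainty_diam_ge0.
by rewrite -ler_pdivlMr // ge_min lexx.
Qed.

(** The positive part in the bound is 1 - w, the weight of [x0] in the chosen path point; w = 1
    matches the convention for zero diameter. *)
Let gap_boundE : gap_bound p x0 rho = (1 - w) * (rho * Lip L * norm2 x0).
Proof.
rewrite /gap_bound -/Xi -/D /w; case: ifPn => _; first by rewrite subrr mul0r.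
rewrite -/L; have -> : Num.max (1 - rho / D) 0 = 1 - Num.min (rho / D) 1.
  by case: (ltP (rho / D) 1) => h; [rewrite max_l|rewrite max_r]; lra.
by ring.
Qed.

Lemma le_dro_opt : (((1 - w) * saa x0 + w * fine (robust_value p xoo))%:E
  <= dro_opt p rho)%E.
Proof.
case: hx0 => -[_ x0min] _; case: hxoo => -[_ xoomin] Mfin.
set M := fine _; have ME : robust_value p xoo = M%:E by rewrite fineK.
apply: le_ereal_inf_tmp => _ [x xfeas <-].
(* The scenario [xi] is taken within e of the robust optimum; it enters with weight w <= 1, so at
   most e is lost. *)
apply/lee_addgt0Pr => e e0.
have : ((M - e)%:E < robust_value p x)%E.
  apply: lt_le_trans (xoomin _ xfeas).
  by rewrite ME lte_fin ltrBlDr ltrDl.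
move=> /ereal_sup_gt[_ [xi Xixi <-]]; rewrite lte_fin => /ltW Me.
have := dro_value_ge x w_ge0 w_le1 wD Xixi.
rewrite -(leeD2rE _ _ (_ : e%:E \is a fin_num)) //; apply: le_trans.
have := x0min _ xfeas; rewrite !saa_valueE lee_fin => saa_le.
rewrite -EFinD lee_fin.
have h1 : (1 - w) * saa x0 <= (1 - w) * saa x by rewrite ler_wpM2l ?subr_ge0.
have h2 : w * (M - e) <= w * loss p x xi by rewrite ler_wpM2l.
have h3 : w * e <= e by rewrite ger_pMl.
lra.
Qed.

Lemma path_value_le : (path_value p x0 xoo rho <=
  ((1 - w) * (saa x0 + rho * Lip L * norm2 x0) +
   w * fine (robust_value p xoo))%:E)%E.
Proof.
case: hxoo => _ Mfin.
apply: (@le_trans _ _ (dro_value p rho ((1 - w) *: x0 + w *: xoo))).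
  apply: ereal_inf_lbound; exists ((1 - w) *: x0 + w *: xoo) => //.
  by exists w => //=; rewrite in_itv /= w_ge0 w_le1.
apply: dro_value_le_convex => //; first exact: dro_value_le_saa.
apply: dro_value_le_robust => xi Xixi; rewrite -lee_fin fineK //.
by apply: ereal_sup_ubound; exists xi.
Qed.

Lemma path_value_gap :
  (path_value p x0 xoo rho - dro_opt p rho <= (gap_bound p x0 rho)%:E)%E.
Proof.
apply: le_trans (leeB path_value_le le_dro_opt) _.
by rewrite -EFinB lee_fin gap_boundE le_eqVlt; apply/orP; left; apply/eqP; ring.
Qed.

End gap.

(** Up to nonnegative factors, the deficit at rho is (D / 2 - rho)^2 / D while the positive part is
    active; beyond D the bound vanishes. *)
Lemma gap_bound_max x0 rho : 0 <= rho ->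
  gap_bound p x0 rho <= gap_bound p x0 (D / 2).
Proof.
move=> rho0; rewrite /gap_bound -/Xi -/D; case: ifPn => // D0.
have {}D0 : 0 < D by rewrite lt_neqAle eq_sym D0 uncertainty_diam_ge0.
rewrite !ler_wpM2r ?norm2_ge0 ?Lip_ge0 //.
have -> : D / 2 / D = 2^-1 by field; exact: lt0r_neq0.
rewrite (@max_l _ _ (1 - 2^-1)); last by lra.
have [h|h] := leP (1 - rho / D) 0; first by rewrite mulr0 mulr_ge0; lra.
rewrite -subr_ge0; have -> : D / 2 * (1 - 2^-1) - rho * (1 - rho / D) =
  (D / 2 - rho) ^+ 2 / D by field; exact: lt0r_neq0.
by rewrite divr_ge0 ?sqr_ge0 // ltW.
Qed.

End problem_theory.

(** * Closed half-spaces *)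

Section halfspaces.
Context {R : realType} {n : nat}.

(** Building block of the tight instance: closedness and convexity pass to finite intersections. *)
Definition halfspace (a : 'rV[R]_n) (c : R) : set 'rV[R]_n :=
  [set x | c <= dot a x].

Lemma halfspaceE a c x : halfspace a c x = (c <= dot a x) :> Prop.
Proof. by []. Qed.

Lemma closed_halfspace a c : closed (halfspace a c).
Proof.
apply: (@closed_comp _ _ (dot a) [set y | c <= y]); last exact: closed_ge.
move=> x _; apply: continuous_big; first exact: add_continuous.
move=> i _ y; apply: continuousM; first exact: cst_continuous.
exact: coord_continuous.
Qed.

Lemma convex_halfspace a c : convex_set (halfspace a c).
Proof.
move=> x y t; rewrite !inE /halfspace /= => xc yc.
rewrite [conv _ _ _]/(t%:num *: (x : 'rV_n) + (1 - t%:num) *: (y : 'rV_n)).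
have -> : c = t%:num * c + (1 - t%:num) * c by ring.
by rewrite dotDr !dotZr lerD // ler_wpM2l // subr_ge0.
Qed.

Lemma convex_setI (A B : set 'rV[R]_n) :
  convex_set A -> convex_set B -> convex_set (A `&` B).
Proof.
move=> cA cB x y t; rewrite !in_setI => /andP[xA xB] /andP[yA yB].
by apply/andP; split; [exact: cA|exact: cB].
Qed.

End halfspaces.

(** * An instance attaining the bound *)

Section tight_instance.
Context {R : realType}.
Variable rho : R.
Hypothesis rho0 : 0 <= rho.

Let vec2 (a b : R) : 'rV[R]_2 := \row_j (if j == 0 then a else b).

Let dot_vec2 a b c d : dot (vec2 a b) (vec2 c d) = a * c + b * d.
Proof. by rewrite /dot !big_ord_recl big_ord0 addr0 !mxE. Qed.

Let vec2_surj (x : 'rV[R]_2) : x = vec2 (x 0 0) (x 0 1).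
Proof.
apply/rowP => i; rewrite mxE; case: ifPn => [/eqP -> //|i0].
by congr (x 0 _); apply/val_inj; case: i i0 => [[|[|]]].
Qed.

Let norm2_vec2 a b : norm2 (vec2 a b) = Num.sqrt (a ^+ 2 + b ^+ 2).
Proof. by rewrite /norm2 dot_vec2 !expr2. Qed.

(* Any D > rho would do; this choice keeps D > 0 when rho = 0. *)
Let D := 2 * rho + 1.

Let D_gt0 : 0 < D. Proof. by rewrite ltr_wpDl ?mulr_ge0. Qed.
Let D_neq0 : D != 0. Proof. exact: lt0r_neq0. Qed.
Let rhoD : rho / D < 1.
Proof.
by rewrite ltr_pdivrMr // mul1r -subr_gt0 /D; have := rho0; lra.
Qed.

(* The four half-spaces of the uncertainty set say 0 <= z <= D and xi_2 = 1. *)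
Definition tight_problem : problem R 2 := {|
  decisions := halfspace (vec2 1 0) 0 `&` halfspace (vec2 0 1) 0
    `&` halfspace (vec2 D 1) rho ;
  uncertainty := halfspace (vec2 1 0) 0 `&` halfspace (vec2 (-1) 0) (- D)
    `&` (halfspace (vec2 0 1) 1 `&` halfspace (vec2 0 (-1)) (-1)) ;
  nb_constraints := 0 ;
  constraint := fun _ _ _ => 0%E ;
  rhs := fun _ => 0 ;
  nb_samples := 1 ;
  samples := [tuple vec2 0 1] ;
  scalar_loss := Num.norm |}.

Let p := tight_problem.

Let decisionsP a b :
  decisions p (vec2 a b) <-> [/\ 0 <= a, 0 <= b & rho <= D * a + b].
Proof.
rewrite /p /= !halfspaceE !dot_vec2 !(mul0r, mul1r, addr0, add0r).
by split=> [[[? ?] ?]|[? ? ?]].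
Qed.

Let uncertaintyP xi :
  uncertainty p xi <-> exists2 z, 0 <= z <= D & xi = vec2 z 1.
Proof.
rewrite (vec2_surj xi); set a := xi 0 0; set b := xi 0 1.
rewrite /p /= !halfspaceE !dot_vec2 !(mul0r, mulN1r, mul1r, addr0, add0r).
rewrite !lerN2; split=> [[[a0 aD] [b1 b1']]|[z /andP[z0 zD] abz]].
  exists a; first by rewrite a0.
  by congr vec2; apply/eqP; rewrite eq_le b1 b1'.
have az : a = z by have := congr1 (fun v : 'rV_2 => v 0 0) abz; rewrite !mxE.
have b1 : b = 1 by have := congr1 (fun v : 'rV_2 => v 0 1) abz; rewrite !mxE.
by rewrite az b1.
Qed.

Let feasibleE : feasible p = decisions p.
Proof. by apply/seteqP; split=> [x []|x xd] //; split=> // xi _ []. Qed.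

Let feasible_saa : feasible p (vec2 1 0).
Proof.
by rewrite feasibleE decisionsP; split => //; have := rho0; rewrite /D; lra.
Qed.

Let feasible_robust : feasible p (vec2 0 rho).
Proof. by rewrite feasibleE decisionsP; split => //; rewrite mulr0 add0r. Qed.

(** Points of the set share their second coordinate, so distances are |z - z'|, and the ends of the
    segment realise D. *)
Let diamE : diam (uncertainty p) = D%:E.
Proof.
apply/eqP; rewrite eq_le; apply/andP; split.
  apply: ge_ereal_sup => _ [[x y] /= [/uncertaintyP + /uncertaintyP + <-]].
  move=> [z /andP[z0 zD] ->] [z' /andP[z'0 z'D] ->]; rewrite lee_fin.
  have -> : vec2 z 1 - vec2 z' 1 = vec2 (z - z') 0.
    by apply/rowP => i; rewrite !mxE; case: ifP => // _; rewrite subrr.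
  rewrite norm2_vec2 expr0n addr0 sqrtr_sqr ler_norml; apply/andP; split; lra.
apply: ereal_sup_ubound; exists (vec2 D 1, vec2 0 1) => /=.
  split; apply/uncertaintyP; [exists D|exists 0] => //; rewrite lexx ?andbT ltW //.
have -> : vec2 D 1 - vec2 0 1 = vec2 D 0.
  by apply/rowP => i; rewrite !mxE; case: ifP => // _; rewrite ?subrr ?subr0.
by rewrite norm2_vec2 expr0n addr0 sqrtr_sqr gtr0_norm.
Qed.

Let lipschitz_norm : 1.-lipschitz (Num.norm : R^o -> R^o).
Proof. by apply/klipschitzE => s t; rewrite mul1r ler_dist_dist. Qed.

Let Lip_norm : Lip (Num.norm : R -> R) = 1.
Proof.
apply/eqP; rewrite eq_le; apply/andP; split.
  apply: ge_inf => //; exists 0 => k; exact: klipschitz_ge0.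
apply: lb_le_inf; first by exists 1.
by move=> k /klipschitzE /(_ 1 0); rewrite normr0 !subr0 normr1 normr1 mulr1.
Qed.

Lemma tight_problem_standing : standing_assumptions p.
Proof.
have xi1 : uncertainty p (vec2 0 1).
  by apply/uncertaintyP; exists 0 => //; rewrite lexx ltW.
split; first split.
- by do !apply: closedI; exact: closed_halfspace.
- by do !apply: convex_setI; exact: convex_halfspace.
split; first split; first by exists (vec2 0 1).
  split; first by do !apply: closedI; exact: closed_halfspace.
  by do !apply: convex_setI; exact: convex_halfspace.
split; first by case.
split; first by exists (vec2 1 0).
split=> //; split; first by move=> i; rewrite (tnth_nth 0) ord1.
split; first by move=> t; exact: normr_ge0.
split; last by split; [exists 1|rewrite diamE ltry].
move=> t x y _ _; rewrite convRE.
rewrite [conv _ _ _]/(t%:num * (x : R) + (1 - t%:num) * (y : R)) /=.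
apply: le_trans (ler_normD _ _) _; rewrite !normrM.
by rewrite (ger0_norm (_ : 0 <= 1 - t%:num)) ?subr_ge0 // (@ger0_norm _ t%:num).
Qed.

(** The only sample, (0, 1), sees just the second coordinate, so (1, 0) reaches the least possible
    value 0. *)
Let saaE a b : saa_value p (vec2 a b) = `|b|%:E.
Proof.
rewrite (saa_valueE tight_problem_standing) big_ord1 /= invr1 mul1r /loss.
by rewrite dot_vec2 mul0r add0r mul1r.
Qed.

Lemma tight_saa_solution : saa_solution p (vec2 1 0).
Proof.
split; last by rewrite saaE.
split=> // y _; rewrite (vec2_surj y) !saaE normr0 lee_fin.
exact: normr_ge0.
Qed.

(** At the scenario (D, 1) the loss is D y_1 + y_2, which the third half-space of the decisions
    keeps above rho. *)
Let robust_ge y : feasible p y -> (rho%:E <= robust_value p y)%E.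
Proof.
rewrite feasibleE (vec2_surj y) => /decisionsP[y0 y1 yrho].
apply: (@le_trans _ _ (loss p (vec2 (y 0 0) (y 0 1)) (vec2 D 1))%:E).
  by rewrite lee_fin /loss dot_vec2 mul1r (le_trans yrho) // ler_norm.
apply: ereal_sup_ubound; exists (vec2 D 1) => //.
by apply/uncertaintyP; exists D => //; rewrite lexx ltW.
Qed.

Let robust_xoo : robust_value p (vec2 0 rho) = rho%:E.
Proof.
apply/eqP; rewrite eq_le robust_ge // andbT.
apply: ge_ereal_sup => _ [_ /uncertaintyP[z _ ->] <-].
by rewrite /loss dot_vec2 mulr0 mul1r add0r /= ger0_norm.
Qed.

Lemma tight_robust_solution : robust_solution p (vec2 0 rho).
Proof.
by split; [split=> // y yf; rewrite robust_xoo robust_ge|rewrite robust_xoo].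
Qed.

Let gap_boundE : gap_bound p (vec2 1 0) rho = rho * (1 - rho / D).
Proof.
rewrite /gap_bound diamE /= (negbTE D_neq0) Lip_norm norm2_vec2.
by rewrite max_l ?subr_ge0 1?ltW // expr1n expr0n addr0 sqrtr1 !mulr1.
Qed.

(** Rules out a degenerate equality 0 = 0 for positive radii. *)
Lemma tight_gap_bound_gt0 : 0 < rho -> 0 < gap_bound p (vec2 1 0) rho.
Proof. by move=> rho1; rewrite gap_boundE mulr_gt0 // subr_gt0. Qed.

(** Moving the mass rho / D to (D, 1) costs at most rho and gives, at parameter t, the value t rho +
    (rho / D) D (1 - t) = rho, independent of t. *)
Let path_value_ge : (rho%:E <= path_value p (vec2 1 0) (vec2 0 rho) rho)%E.
Proof.
apply: le_ereal_inf_tmp => _ [_ [t + <-] <-]; rewrite /= in_itv /= => /andP[t0 t1].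
have -> : (1 - t) *: vec2 1 0 + t *: vec2 0 rho = vec2 (1 - t) (t * rho).
  by apply/rowP => i; rewrite !mxE; case: ifP => _; ring.
have D1 : uncertainty p (vec2 D 1).
  by apply/uncertaintyP; exists D => //; rewrite lexx ltW.
have w0 : 0 <= rho / D by rewrite divr_ge0 // ltW.
have wD : rho / D * fine (diam (uncertainty p)) <= rho.
  by rewrite diamE /= divfK.
have := dro_value_ge tight_problem_standing (vec2 (1 - t) (t * rho)) w0
  (ltW rhoD) wD D1.
apply: le_trans.
rewrite lee_fin big_ord1 /= invr1 mul1r /loss !dot_vec2 /= mul0r add0r !mul1r.
rewrite !ger0_norm ?addr_ge0 ?mulr_ge0 ?subr_ge0 //; last exact: ltW.
by rewrite le_eqVlt; apply/orP; left; apply/eqP; field.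
Qed.

(** The point (rho / D, 0) has sample loss 0 and norm rho / D, so the Lipschitz estimate bounds its
    value by rho^2 / D. *)
Let dro_opt_le : (dro_opt p rho <= (rho * (rho / D))%:E)%E.
Proof.
apply: (@le_trans _ _ (dro_value p rho (vec2 (rho / D) 0))).
  apply: ereal_inf_lbound; exists (vec2 (rho / D) 0) => //.
  rewrite feasibleE decisionsP; split => //; first by rewrite divr_ge0 // ltW.
  by rewrite addr0 mulrC divfK.
apply: le_trans (dro_value_le_saa tight_problem_standing _ _) _.
rewrite lee_fin big_ord1 /= invr1 mul1r /loss dot_vec2 /= mul0r mulr0 addr0.
rewrite normr0 add0r Lip_norm mulr1 norm2_vec2 expr0n addr0 sqrtr_sqr.
by rewrite ger0_norm // divr_ge0 // ltW.
Qed.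

Lemma tight_gap : (path_value p (vec2 1 0) (vec2 0 rho) rho - dro_opt p rho)%E =
  (gap_bound p (vec2 1 0) rho)%:E.
Proof.
apply/eqP; rewrite eq_le; apply/andP; split.
  exact: (path_value_gap tight_problem_standing tight_saa_solution
    tight_robust_solution rho0).
(* The two estimates leave rho - rho^2 / D, which is the gap bound since rho < D. *)
apply: le_trans (leeB path_value_ge dro_opt_le).
by rewrite -EFinB lee_fin gap_boundE mulrBr mulr1.
Qed.

Lemma tight_instance_ex :
  exists (n : nat) (p : problem R n) (x0 xoo : 'rV[R]_n),
       [/\ (0 < n)%N, standing_assumptions p, saa_solution p x0,
           robust_solution p xoo &
           (path_value p x0 xoo rho - dro_opt p rho)%E
             = (gap_bound p x0 rho)%:E
           /\ (0 < rho -> 0 < gap_bound p x0 rho)].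
Proof.
exists 2, p, (vec2 1 0), (vec2 0 rho); split => //.
- exact: tight_problem_standing.
- exact: tight_saa_solution.
- exact: tight_robust_solution.
- by split; [exact: tight_gap|exact: tight_gap_bound_gt0].
Qed.

End tight_instance.

Theorem theorem1 (R : realType) :
  (forall (n : nat) (p : problem R n) (x0 xoo : 'rV[R]_n),
     standing_assumptions p -> saa_solution p x0 -> robust_solution p xoo ->
     (forall rho : R, 0 <= rho ->
        (exists2 x, shrinkage_path x0 xoo x &
                    dro_value p rho x = path_value p x0 xoo rho) /\
        (path_value p x0 xoo rho - dro_opt p rho
           <= (gap_bound p x0 rho)%:E)%E) /\
     (forall rho : R, 0 <= rho ->
        gap_bound p x0 rho
          <= gap_bound p x0 (fine (diam (uncertainty p)) / 2))) /\
  (forall rho : R, 0 <= rho ->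
     exists (n : nat) (p : problem R n) (x0 xoo : 'rV[R]_n),
       [/\ (0 < n)%N, standing_assumptions p, saa_solution p x0,
           robust_solution p xoo &
           (path_value p x0 xoo rho - dro_opt p rho)%E
             = (gap_bound p x0 rho)%:E
           /\ (0 < rho -> 0 < gap_bound p x0 rho)]).
Proof.
split=> [n p x0 xoo hp hx0 hxoo|rho rho0]; last exact: tight_instance_ex.
split=> rho rho0; last exact: gap_bound_max.
by split; [exact: path_value_attained|exact: path_value_gap].
Qed.
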